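(* Let $d\in\{2,3\}$, let $n\ge 2$, let $e_1,\dots,e_n\in\mathbb{R}^d$ be vectors with $\sum_{j=1}^n|e_j|=2$, let $\mathcal{P}=\mathcal{P}(e_1,\dots,e_n)$ be their edge set ensemble, and let $\ell=\left|\sum_{j=1}^n e_j\right|$. If $\ell>0$, then $$\mathrm{sGyradius}(\mathcal{P})=\frac{n+2}{12(n+1)}\left(\sum_{j=1}^n|e_j|^2+\ell^2\right).$$ If $\ell=0$ (the polygons are closed and regarded as having $n$ vertices), then $$\mathrm{sGyradius}(\mathcal{P})=\frac{n+1}{12n}\sum_{j=1}^n|e_j|^2 .$$
   Context: A polygon with $n$ edges in $\mathbb{R}^d$, up to translation, is an ordered list of edge vectors $(e_1,\dots,e_n)$; all polygons have total length $2$. Its vertices are $v_1$ (arbitrary) and $v_{m+1}=v_m+e_m$. The edge set ensemble $\mathcal{P}(e_1,\dots,e_n)$ is the collection of polygons $(e_{\sigma(1)},\dots,e_{\sigma(n)})$, $\sigma\in S_n$. The (squared) radius of gyration is half of the average squared distance between two vertices (including pairs of repeated vertices): for an open polygon, which has $n+1$ vertices, $$\mathrm{Gyradius}(e_1,\dots,e_n)=\frac1{2(n+1)^2}\sum_{i,j=1}^{n+1}|v_i-v_j|^2,$$ and for a closed polygon, which has one fewer vertex ($v_{n+1}=v_1$ is not counted twice), $$\mathrm{Gyradius}(e_1,\dots,e_n)=\frac1{2n^2}\sum_{i,j=1}^{n}|v_i-v_j|^2 .$$ The symmetrized version is $\mathrm{sGyradius}(\mathcal{P})=\frac1{n!}\sum_{\sigma\in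 S_n}\mathrm{Gyradius}(e_{\sigma(1)},\dots,e_{\sigma(n)})$. *)

(* Defs.v *)
From mathcomp Require Import all_boot all_order all_algebra all_fingroup.
From mathcomp Require Import reals.

Set Implicit Arguments.
Unset Strict Implicit.
Unset Printing Implicit Defensive.

Import Order.TTheory GRing.Theory Num.Theory.

Local Open Scope ring_scope.

(* The norm that MathComp-Analysis puts on row vectors is the sup norm, so the
   Euclidean one is defined here. *)
Definition enorm (R : realType) (d : nat) (x : 'rV[R]_d) : R :=
  Num.sqrt (\sum_(k < d) x 0 k ^+ 2).

Definition polygon (R : realType) (d n : nat) : Type := 'I_n -> 'rV[R]_d.

(* Vertices are numbered from 0: [vertex v1 e m] is v_{m+1}. *)
Definition vertex (R : realType) (d n : nat) (v1 : 'rV[R]_d)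
    (e : polygon R d n) (m : nat) : 'rV[R]_d :=
  v1 + \sum_(k < n | (k < m)%N) e k.

Lemma vertex0 (R : realType) (d n : nat) (v1 : 'rV[R]_d) (e : polygon R d n) :
  vertex v1 e 0 = v1.
Proof. by rewrite /vertex big_pred0 ?addr0. Qed.

Lemma vertexS (R : realType) (d n : nat) (v1 : 'rV[R]_d) (e : polygon R d n)
    (m : 'I_n) :
  vertex v1 e m.+1 = vertex v1 e m + e m.
Proof.
rewrite /vertex -addrA; congr (_ + _).
rewrite (bigD1 m) //= addrC; congr (_ + _); apply: eq_bigl => k.
by rewrite ltnS [RHS]ltn_neqAle andbC.
Qed.

Definition closed_polygon (R : realType) (d n : nat) (e : polygon R d n) : bool :=
  \sum_(k < n) e k == 0.

(* In a closed polygon v_{n+1} = v_1 is not counted twice. *)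
Definition nb_vertices (R : realType) (d n : nat) (e : polygon R d n) : nat :=
  if closed_polygon e then n else n.+1.

(* Polygons are taken up to translation; the representative with v_1 = 0 is
   used, see [gyradius_translation]. *)
Definition gyradius (R : realType) (d n : nat) (e : polygon R d n) : R :=
  let N := nb_vertices e in
  1 / (2 * N%:R ^+ 2) *
    \sum_(i < N) \sum_(j < N) enorm (vertex 0 e i - vertex 0 e j) ^+ 2.

Lemma gyradius_translation (R : realType) (d n : nat) (v1 : 'rV[R]_d)
    (e : polygon R d n) :
  gyradius e =
    let N := nb_vertices e in
    1 / (2 * N%:R ^+ 2) *
      \sum_(i < N) \sum_(j < N) enorm (vertex v1 e i - vertex v1 e j) ^+ 2.
Proof.
rewrite /gyradius /=; congr (_ * _).
apply: eq_bigr => i _; apply: eq_bigr => j _; congr (enorm _ ^+ 2).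
by rewrite /vertex !add0r opprD addrACA subrr add0r.
Qed.

(* The ensemble is a family indexed by permutations, not a set of polygons:
   repeated edges give repeated polygons. *)
Definition edge_set_ensemble (R : realType) (d n : nat) (e : polygon R d n) :
    'S_n -> polygon R d n :=
  fun s k => e (s k).

Definition sgyradius (R : realType) (d n : nat) (P : 'S_n -> polygon R d n) : R :=
  1 / n`!%:R * \sum_(s : 'S_n) gyradius (P s).

(* Main.v *)
(* Averaging over permutations, each edge vector has mean squared norm S / n and
   each ordered pair of distinct edges has mean scalar product
   (l^2 - S) / (n (n - 1)), with S the sum of the |e_j|^2.  Hence two vertices m
   steps apart have mean squared distance
   m S / n + m (m - 1) (l^2 - S) / (n (n - 1)), and it remains to sum |i - j| and
   |i - j|^2 over all pairs of vertices. *)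

Require Import Defs.
From mathcomp Require Import all_boot all_order all_algebra all_fingroup.
From mathcomp Require Import reals ring.

Set Implicit Arguments.
Unset Strict Implicit.
Unset Printing Implicit Defensive.

Import Order.TTheory GRing.Theory Num.Theory.

Local Open Scope ring_scope.

(** Composing [s] with a transposition shows that the left sum does not depend on [a]. Summed over
    all [a], it gives the full sum of [f] once for each [s], since [s] is a bijection. *)
Lemma sum_perm_point (R : comPzRingType) (n : nat) (f : 'I_n -> R) (a : 'I_n) :
  n%:R * \sum_(s : 'S_n) f (s a) = n`!%:R * \sum_(i < n) f i.
Proof.
have moveE b : \sum_(s : 'S_n) f (s b) = \sum_(s : 'S_n) f (s a).
  rewrite (reindex_inj (mulgI (tperm a b))); apply: eq_bigr => s _.
  by rewrite permM tpermR.
transitivity (\sum_(b < n) \sum_(s : 'S_n) f (s b)).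
  by rewrite (eq_bigr _ (fun b _ => moveE b)) sumr_const card_ord mulr_natl.
rewrite exchange_big /= (eq_bigr (fun=> \sum_(i < n) f i)) => [|s _].
  by rewrite sumr_const card_Sn mulr_natl.
by rewrite [RHS](reindex_inj (@perm_inj _ s)).
Qed.

Lemma sum_perm_pair (R : comPzRingType) (n : nat) (g : 'I_n -> 'I_n -> R)
    (a b : 'I_n) : b != a ->
  n%:R * (n%:R - 1) * \sum_(s : 'S_n) g (s a) (s b) =
    n`!%:R * \sum_(i < n) \sum_(j < n | j != i) g i j.
Proof.
(* Read backwards with f i the inner sum over j != i, [sum_perm_point] accounts for the factor n.
   The factor n - 1 will count the indices c != a that can replace [b]: swapping [b] and c fixes
   [a]. *)
move=> ba; rewrite -(sum_perm_point _ a) -mulrA; congr (_ * _).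
have moveE c : c != a ->
    \sum_(s : 'S_n) g (s a) (s c) = \sum_(s : 'S_n) g (s a) (s b).
  move=> ca; rewrite (reindex_inj (mulgI (tperm b c))); apply: eq_bigr => s _.
  by rewrite !permM tpermR tpermD.
transitivity (\sum_(c < n | c != a) \sum_(s : 'S_n) g (s a) (s c)).
  rewrite (eq_bigr _ moveE) sumr_const cardC1 card_ord -[RHS]mulr_natl.
  suff -> : n%:R = n.-1%:R + 1 :> R by rewrite addrK.
  by rewrite natr1 (ltn_predK (ltn_ord a)).
rewrite exchange_big; apply: eq_bigr => s _ /=.
rewrite [RHS](reindex_inj (@perm_inj _ s)).
by apply: eq_bigl => c; rewrite (inj_eq perm_inj).
Qed.

Definition dotv (R : pzRingType) (d : nat) (x y : 'rV[R]_d) : R :=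
  \sum_(k < d) x 0 k * y 0 k.

Lemma enorm_sqr (R : realType) (d : nat) (x : 'rV[R]_d) :
  enorm x ^+ 2 = dotv x x.
Proof.
rewrite /enorm sqr_sqrtr; first by apply: eq_bigr => k _; rewrite expr2.
by apply: sumr_ge0 => k _; apply: sqr_ge0.
Qed.

(** Closedness is tested on a vector, while the final case split is on the length [ell]; this
    connects the two. *)
Lemma enorm0P (R : realType) (d : nat) (x : 'rV[R]_d) :
  reflect (enorm x = 0) (x == 0).
Proof.
apply: (iffP eqP) => [->|x0].
  by rewrite /enorm big1 ?sqrtr0 // => k _; rewrite mxE expr0n.
apply/rowP => k; rewrite mxE; apply/eqP; rewrite -sqrf_eq0; apply/eqP.
have : \sum_(k < d) x 0 k ^+ 2 = 0.
  transitivity (enorm x ^+ 2); last by rewrite x0 expr0n.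
  by rewrite enorm_sqr; apply: eq_bigr => j _; rewrite expr2.
by move/psumr_eq0P; apply=> // j _; apply: sqr_ge0.
Qed.

Lemma enormB_sym (R : realType) (d : nat) (x y : 'rV[R]_d) :
  enorm (x - y) = enorm (y - x).
Proof.
by congr Num.sqrt; apply: eq_bigr => k _; rewrite -sqrrN !mxE opprB.
Qed.

Lemma dotv_sum (R : pzRingType) (d : nat) (I : finType) (P : pred I)
    (x : I -> 'rV[R]_d) :
  dotv (\sum_(i | P i) x i) (\sum_(i | P i) x i) =
    \sum_(i | P i) \sum_(j | P j) dotv (x i) (x j).
Proof.
rewrite /dotv (eq_bigr (fun k => \sum_(i | P i) \sum_(j | P j)
  x i 0 k * x j 0 k)) => [|k _]; last by rewrite summxE big_distrlr.
rewrite exchange_big; apply: eq_bigr => i _ /=.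
by rewrite exchange_big.
Qed.

(** Expanding the square leaves #|A| diagonal scalar products and #|A|(#|A| - 1) off-diagonal ones,
    and symmetrization makes the terms of each kind equal. Only the size of [A] matters. *)
Lemma sum_perm_subset (R : realType) (d n : nat) (e : 'I_n -> 'rV[R]_d)
    (A : {set 'I_n}) :
  let S := \sum_(j < n) enorm (e j) ^+ 2 in
  let L := enorm (\sum_(j < n) e j) ^+ 2 in
  n%:R * (n%:R - 1) * \sum_(s : 'S_n) enorm (\sum_(a in A) e (s a)) ^+ 2 =
    n`!%:R * (#|A|%:R * ((n%:R - 1) * S + (#|A|%:R - 1) * (L - S))).
Proof.
move=> S L; pose g i j := dotv (e i) (e j).
have SE : \sum_i g i i = S by apply: eq_bigr => i _; rewrite enorm_sqr.
have LE : \sum_i \sum_(j | j != i) g i j = L - S.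
  rewrite /L enorm_sqr dotv_sum -SE -sumrB; apply: eq_bigr => i _.
  by rewrite [X in _ = X - _](bigD1 i) //= addrAC subrr add0r.
pose T a b := n%:R * (n%:R - 1) * \sum_(s : 'S_n) g (s a) (s b).
have TE a : a \in A -> \sum_(b in A) T a b =
    n`!%:R * ((n%:R - 1) * S + (#|A|%:R - 1) * (L - S)).
  (* The diagonal term keeps a factor n - 1, because [sum_perm_point] absorbs only n; each of the
     other #|A| - 1 terms absorbs n(n - 1) and yields L - S. *)
  move=> aA; rewrite (bigD1 a) //= (eq_bigr (fun=> n`!%:R * (L - S))).
    rewrite sumr_const -[X in _ + X]mulr_natl /T mulrAC (sum_perm_point (fun i => g i i)) SE.
    have -> : #|[pred b in A | b != a]|%:R = #|A|%:R - 1 :> R.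
      rewrite (cardD1 a A) aA natrD addrAC subrr add0r; congr (_%:R).
      by apply: eq_card => b; rewrite !inE andbC.
    by ring.
  by move=> b /andP[_ ba]; rewrite /T sum_perm_pair // LE.
transitivity (\sum_(a in A) \sum_(b in A) T a b).
  under [RHS]eq_bigr do rewrite -mulr_sumr.
  rewrite -mulr_sumr; congr (_ * _).
  under [RHS]eq_bigr do rewrite exchange_big /=.
  rewrite [RHS]exchange_big; apply: eq_bigr => s _ /=.
  by rewrite enorm_sqr dotv_sum.
by rewrite (eq_bigr _ TE) sumr_const -[LHS]mulr_natl; ring.
Qed.

(** The two vertices differ, up to sign, by the sum of the m = |i - j| edges between them. Writing m
    as [|x|] and m(m - 1) as x^2 - |x| makes the formula symmetric in i and j and ready for
    summation over all pairs. *)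
Lemma sum_perm_vertex_dist (R : realType) (d n : nat) (e : 'I_n -> 'rV[R]_d)
    (i j : nat) : (i <= n)%N -> (j <= n)%N ->
  let S := \sum_(j < n) enorm (e j) ^+ 2 in
  let L := enorm (\sum_(j < n) e j) ^+ 2 in
  let x : R := i%:R - j%:R in
  n%:R * (n%:R - 1) * \sum_(s : 'S_n)
    enorm (vertex 0 (edge_set_ensemble e s) i -
           vertex 0 (edge_set_ensemble e s) j) ^+ 2 =
    n`!%:R * (`|x| * ((n%:R - 1) * S) + (x ^+ 2 - `|x|) * (L - S)).
Proof.
move=> + + S L; wlog ij : i j / (j <= i)%N => [hw ilen jlen x|].
  have [/hw|/ltnW /hw] := leqP j i; first exact.
  move=> /(_ jlen ilen); rewrite distrC -(sqrrN (_ - _)) opprB => <-.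
  by congr (_ * _); apply: eq_bigr => s _; rewrite enormB_sym.
move=> ilen _ x; pose A := [set k : 'I_n | (j <= k < i)%N].
have cardA : #|A|%:R = x.
  rewrite /x -natrB //; congr (_%:R).
  transitivity (\sum_(j <= k < i) 1)%N; last by rewrite sum_nat_const_nat muln1.
  rewrite (big_nat_widenl _ 0) // big_mkord -sum1dep_card.
  by rewrite (big_ord_widen_cond n (fun k => true && (j <= k)%N) (fun=> 1%N)).
rewrite ger0_norm; last by rewrite -cardA.
transitivity (n%:R * (n%:R - 1) *
    \sum_(s : 'S_n) enorm (\sum_(a in A) e (s a)) ^+ 2); last first.
  by rewrite sum_perm_subset cardA -/S -/L; ring.
congr (_ * _); apply: eq_bigr => s _; congr (enorm _ ^+ 2).
(* The edges before j make up vertex j and cancel; those left have j <= k < i, which is [A]. *)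
rewrite /vertex !add0r (bigID (fun k : 'I_n => (k < j)%N)) /= addrC.
rewrite [X in _ + X - _](eq_bigl (fun k : 'I_n => (k < j)%N)) => [|k].
  by rewrite addrK; apply: eq_bigl => k; rewrite inE -leqNgt andbC.
by rewrite andb_idl // => /leq_trans; apply.
Qed.

(** Going from N to N + 1 adds a last row and a last column, each with sum 1 + ... + N, and a zero
    corner. *)
Lemma sum_dist_ord (R : realFieldType) (N : nat) :
  \sum_(i < N) \sum_(j < N) `|i%:R - j%:R| = (N%:R ^+ 3 - N%:R) / 3 :> R.
Proof.
have tri M : \sum_(i < M) (M%:R - i%:R) = M%:R * (M%:R + 1) / 2 :> R.
  elim: M => [|M IH]; first by rewrite big_ord0 mul0r mul0r.
  (* The term i = 0 is removed because (M + 1) - (i + 1) = M - i turns the rest into the sum for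
     M. *)
  rewrite big_ord_recl subr0 (eq_bigr (fun i : 'I_M => M%:R - i%:R)) => [|i _].
    by rewrite IH -natr1; field.
  by rewrite lift0 -!natr1; ring.
elim: N => [|N IH]; first by rewrite big_ord0 expr0n subrr mul0r.
rewrite big_ord_recr /=; under eq_bigr do rewrite big_ord_recr /=.
rewrite big_split /= IH big_ord_recr /= subrr normr0 addr0.
have absE (i : 'I_N) : `|N%:R - i%:R| = N%:R - i%:R :> R.
  by rewrite ger0_norm // subr_ge0 ler_nat ltnW.
rewrite (eq_bigr _ (fun i _ => absE i)) (eq_bigr (fun i : 'I_N => N%:R - i%:R)).
  by rewrite tri -natr1; field.
by move=> i _; rewrite distrC absE.
Qed.

Lemma sum_sqr_dist_ord (R : realFieldType) (N : nat) :
  \sum_(i < N) \sum_(j < N) (i%:R - j%:R) ^+ 2 =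
    N%:R ^+ 2 * (N%:R ^+ 2 - 1) / 6 :> R.
Proof.
have pyr M : \sum_(i < M) (M%:R - i%:R) ^+ 2 =
    M%:R * (M%:R + 1) * (2 * M%:R + 1) / 6 :> R.
  elim: M => [|M IH]; first by rewrite big_ord0 !mul0r.
  rewrite big_ord_recl subr0.
  rewrite (eq_bigr (fun i : 'I_M => (M%:R - i%:R) ^+ 2)) => [|i _].
    by rewrite IH -natr1; field.
  by rewrite lift0 -!natr1; ring.
elim: N => [|N IH]; first by rewrite big_ord0 expr0n !mul0r.
rewrite big_ord_recr /=; under eq_bigr do rewrite big_ord_recr /=.
rewrite big_split /= IH big_ord_recr /= subrr expr0n addr0 pyr.
rewrite (eq_bigr (fun i : 'I_N => (N%:R - i%:R) ^+ 2)) => [|i _]; last by ring.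
by rewrite pyr -natr1; field.
Qed.

(** Leaving the number N of vertices symbolic treats open and closed polygons together. *)
Lemma sgyradius_nb_vertices (R : realType) (d n : nat) (e : 'I_n -> 'rV[R]_d) :
  (2 <= n)%N ->
  let S := \sum_(j < n) enorm (e j) ^+ 2 in
  let L := enorm (\sum_(j < n) e j) ^+ 2 in
  let N := nb_vertices e in
  let x : R := N%:R in
  sgyradius (edge_set_ensemble e) =
    1 / (2 * x ^+ 2) / (n%:R * (n%:R - 1)) *
      ((x ^+ 3 - x) / 3 * ((n%:R - 1) * S) +
       (x ^+ 2 * (x ^+ 2 - 1) / 6 - (x ^+ 3 - x) / 3) * (L - S)).
Proof.
move=> n2 S L N x.
(* Permuting the edges preserves their sum, so the whole ensemble is closed or the whole ensemble is
   open. *)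
have NE s : nb_vertices (edge_set_ensemble e s) = N.
  rewrite /N /nb_vertices /closed_polygon /edge_set_ensemble.
  by rewrite [in RHS](reindex_inj (@perm_inj _ s)).
have len (i : 'I_N) : (i <= n)%N.
  by rewrite -ltnS (leq_trans (ltn_ord i)) // /N /nb_vertices; case: ifP.
have n0 : n%:R != 0 :> R by rewrite pnatr_eq0 -lt0n (ltn_trans _ n2).
have n1 : n%:R - 1 != 0 :> R.
  by rewrite subr_eq0 pnatr_eq1; case: n n2 {e S L N x NE len n0} => [|[]].
have f0 : n`!%:R != 0 :> R by rewrite pnatr_eq0 -lt0n fact_gt0.
pose D s i j := enorm (vertex 0 (edge_set_ensemble e s) i -
                       vertex 0 (edge_set_ensemble e s) j) ^+ 2.
have key : n%:R * (n%:R - 1) *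
    \sum_(s : 'S_n) \sum_(i < N) \sum_(j < N) D s i j =
    n`!%:R * ((x ^+ 3 - x) / 3 * ((n%:R - 1) * S) +
       (x ^+ 2 * (x ^+ 2 - 1) / 6 - (x ^+ 3 - x) / 3) * (L - S)).
  (* With the sum over permutations innermost and the closed forms turned back into double sums, the
     identity holds term by term in i and j. *)
  rewrite exchange_big /=; under eq_bigr do rewrite exchange_big /=.
  rewrite -sum_dist_ord -sum_sqr_dist_ord -sumrB !mulr_suml -big_split /=.
  rewrite !mulr_sumr; apply: eq_bigr => i _.
  rewrite -sumrB !mulr_suml -big_split /= !mulr_sumr; apply: eq_bigr => j _.
  by rewrite -[\sum_(k < n) _]mulr_sumr; exact: sum_perm_vertex_dist.
have gyrE s : gyradius (edge_set_ensemble e s) =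
    1 / (2 * x ^+ 2) * \sum_(i < N) \sum_(j < N) D s i j.
  by rewrite /gyradius NE.
rewrite /sgyradius (eq_bigr _ (fun s _ => gyrE s)) -mulr_sumr.
have -> : \sum_(s : 'S_n) \sum_(i < N) \sum_(j < N) D s i j =
    (n%:R * (n%:R - 1))^-1 * (n`!%:R *
      ((x ^+ 3 - x) / 3 * ((n%:R - 1) * S) +
       (x ^+ 2 * (x ^+ 2 - 1) / 6 - (x ^+ 3 - x) / 3) * (L - S))).
  by rewrite -key mulKf // mulf_neq0.
by rewrite !(mulrCA _ n`!%:R) !div1r mulVKf // mulrA.
Qed.

Theorem proposition17 (R : realType) (d n : nat) (e : 'I_n -> 'rV[R]_d)
    (hd : d = 2%N \/ d = 3%N) (hn : (2 <= n)%N)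
    (hlen : \sum_(j < n) enorm (e j) = 2) :
  let ell := enorm (\sum_(j < n) e j) in
  (0 < ell ->
    sgyradius (edge_set_ensemble e) =
      (n%:R + 2) / (12 * (n%:R + 1)) *
        (\sum_(j < n) enorm (e j) ^+ 2 + ell ^+ 2)) /\
  (ell = 0 ->
    sgyradius (edge_set_ensemble e) =
      (n%:R + 1) / (12 * n%:R) * \sum_(j < n) enorm (e j) ^+ 2).
Proof.
move=> ell; have n0 : n%:R != 0 :> R by rewrite pnatr_eq0 -lt0n (ltn_trans _ hn).
have n1 : n%:R - 1 != 0 :> R.
  by rewrite subr_eq0 pnatr_eq1 neq_ltn hn orbT.
have nS : n%:R + 1 != 0 :> R by rewrite natr1 pnatr_eq0.
rewrite sgyradius_nb_vertices // /nb_vertices /closed_polygon -/ell.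
split=> [ell_gt0|ell0].
  have /enorm0P/negPf -> : enorm (\sum_(k < n) e k) <> 0.
    by move=> h; rewrite /ell h ltxx in ell_gt0.
  (* For N = n + 1 the coefficient of L - S is n(n + 1)(n + 2)(n - 1)/6, half that of S, so S and L
     end with equal weights. *)
  rewrite -natr1; field; by rewrite n1 n0 nS.
(* Now N = n and L = 0, so the off-diagonal part contributes a multiple of -S. *)
rewrite (introT (enorm0P _) ell0) ell0; field; by rewrite n0 n1.
Qed.
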